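(* For every $d\ge 2$, $\operatorname{cr_e}(d)\le\operatorname{cr_e}(d-1)+1$.
   Context: A lattice simplex in $\mathbb{R}^d$ is the convex hull of $d+1$ affinely independent points of $\mathbb{Z}^d$; it is empty if its only lattice points are its vertices. After translating a vertex to the origin, write $\Delta=AS_d$ with $S_d=\operatorname{conv}\{\mathbf{0},e_1,\ldots,e_d\}$, $A\in\mathbb{Z}^{d\times d}$ invertible; $G_\Delta=\mathbb{Z}^d/A\mathbb{Z}^d$, and the cyclicity rank $\operatorname{cr}(\Delta)$ is the number of elementary divisors of $A$ larger than $1$ (the minimal number of cyclic factors of $G_\Delta$). $\operatorname{cr_e}(d)$ is the maximum of $\operatorname{cr}(\Delta)$ over all empty lattice simplices $\Delta\subseteq\mathbb{R}^d$. *)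

(* Defs.v *)
From mathcomp Require Import all_boot all_order all_algebra.
From mathcomp Require Import boolp classical_sets reals.
Set Implicit Arguments.
Unset Strict Implicit.
Unset Printing Implicit Defensive.
Import Order.TTheory GRing.Theory Num.Theory.
Local Open Scope classical_set_scope.
Local Open Scope ring_scope.

Section EuclideanSpace.
Variables (R : realType) (d : nat).

Definition affinely_independent n (p : 'I_n -> 'cV[R]_d) : Prop :=
  forall c : 'I_n -> R,
    \sum_i c i = 0 -> \sum_i c i *: p i = 0 -> forall i, c i = 0.

Definition convex_hull n (p : 'I_n -> 'cV[R]_d) : set 'cV[R]_d :=
  [set x | exists c : 'I_n -> R,
     [/\ forall i, 0 <= c i, \sum_i c i = 1 & x = \sum_i c i *: p i]].

Definition lattice_point (z : 'cV[int]_d) : 'cV[R]_d := map_mx intr z.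

(* A lattice simplex is given by a listing of its d+1 vertices. *)
Definition lattice_simplex (v : 'I_d.+1 -> 'cV[int]_d) : Prop :=
  affinely_independent (fun i => lattice_point (v i)).

Definition simplex (v : 'I_d.+1 -> 'cV[int]_d) : set 'cV[R]_d :=
  convex_hull (fun i => lattice_point (v i)).

Definition empty_lattice_simplex (v : 'I_d.+1 -> 'cV[int]_d) : Prop :=
  lattice_simplex v /\
  forall z : 'cV[int]_d, simplex v (lattice_point z) -> exists i, z = v i.

End EuclideanSpace.

Section CyclicityRank.
Variable d : nat.

Definition smith_form (A : 'M[int]_d) (s : 'rV[int]_d) : Prop :=
  [/\ forall i, 0 <= s 0 i,
      forall i j : 'I_d, (i <= j)%N -> (s 0%R i %| s 0%R j)%Z &
      exists P Q : 'M[int]_d,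
        [/\ P \in unitmx, Q \in unitmx & A = P *m diag_mx s *m Q]].

(* A row with smith_form exists by smith_form_exists; it is unique because
   s 0 0 * ... * s 0 k is the gcd of the minors of A of size k+1. *)
Definition elementary_divisors (A : 'M[int]_d) : 'rV[int]_d :=
  xget 0 [set s | smith_form A s].

(* The columns of edge_matrix v are the vertices other than v ord0, after
   translating v ord0 to the origin. *)
Definition edge_matrix (v : 'I_d.+1 -> 'cV[int]_d) : 'M[int]_d :=
  \matrix_(i, j) (v (lift ord0 j) i 0 - v ord0 i 0).

Definition cyclicity_rank (v : 'I_d.+1 -> 'cV[int]_d) : nat :=
  #|[pred i | 1 < elementary_divisors (edge_matrix v) 0 i]|.

Lemma smith_form_exists (A : 'M[int]_d) : exists s, smith_form A s.
Proof.
have [L uL [Q uQ [s sS ->]]] := int_Smith_normal_form A.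
pose sg (x : int) : int := if x < 0 then -1 else 1.
have sgE x : x = `|x| * sg x.
  rewrite /sg; case: ifPn => [x_lt0|]; first by rewrite ltr0_norm // mulrN1 opprK.
  by rewrite -leNgt => x_ge0; rewrite ger0_norm // mulr1.
exists (\row_i `|s`_i|); split.
- by move=> i; rewrite mxE.
- move=> i j le_ij; rewrite !mxE dvdzE !absz_id -dvdzE.
  have [lt_j|le_s] := ltnP j (size s); last by rewrite (nth_default 0 le_s) dvdz0.
  have := sorted_leq_nth (@dvdz_trans) (@dvdzz) 0 sS.
  by move=> /(_ i j); rewrite !inE; apply=> //; apply: leq_ltn_trans lt_j.
- exists L, (diag_mx (\row_i sg s`_i) *m Q); split=> //.
    rewrite unitmx_mul uQ andbT unitmxE det_diag.
    rewrite rpred_prod// => i _; rewrite mxE /sg.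
    by case: ifP; rewrite ?unitrN unitr1.
  rewrite !mulmxA; congr (_ *m _); rewrite -!mulmxA; congr (_ *m _).
  rewrite mulmx_diag; apply/matrixP => i j; rewrite !mxE -sgE.
  by rewrite -val_eqE.
Qed.

Lemma elementary_divisorsP (A : 'M[int]_d) :
  smith_form A (elementary_divisors A).
Proof. exact: (xgetPex 0 (smith_form_exists A)). Qed.

End CyclicityRank.

Definition cr_value (R : realType) (d k : nat) : Prop :=
  exists2 v : 'I_d.+1 -> 'cV[int]_d,
    empty_lattice_simplex R v & cyclicity_rank v = k.

(* The standard simplex is empty, so cr_value is inhabited. *)
Lemma cr_value_inhabited (R : realType) (d : nat) :
  exists k, `[< cr_value R d k >].
Proof.
pose v (i : 'I_d.+1) : 'cV[int]_d :=
  if unlift ord0 i is Some j then delta_mx j 0 else 0.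
suff ev : empty_lattice_simplex R v.
  by exists (cyclicity_rank v); apply/asboolP; exists v.
have v0 : v ord0 = 0 by rewrite /v unlift_none.
have vS j : v (lift ord0 j) = delta_mx j 0 by rewrite /v liftK.
have sumE (c : 'I_d.+1 -> R) j :
    (\sum_i c i *: lattice_point R (v i)) j 0 = c (lift ord0 j).
  rewrite big_ord_recl v0 /lattice_point map_mx0 scaler0 add0r summxE.
  rewrite (bigD1 j) //= vS !mxE !eqxx mulr1 big1 ?addr0 // => i ij.
  by rewrite vS !mxE eq_sym (negPf ij) mulr0.
split=> [c c0 cv|z [c [c_ge0 c1 zE]]].
  have cS j : c (lift ord0 j) = 0 by rewrite -sumE cv mxE.
  move=> i; have [j ->|->] := unliftP ord0 i; first exact: cS.
  by move: c0; rewrite big_ord_recl big1 ?addr0.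
have zc j : (z j 0)%:~R = c (lift ord0 j) by rewrite -sumE -zE mxE.
have z_ge0 j : 0 <= z j 0 by rewrite -(ler0z R) zc.
have zsum : \sum_j z j 0 <= 1.
  rewrite -(ler_int R) rmorph_sum [leRHS](_ : _ = \sum_i c i) // big_ord_recl.
  by rewrite (eq_bigr _ (fun j _ => zc j)) lerDr.
have [j zj|z0] := pickP (fun j => z j 0 != 0); last first.
  exists ord0; rewrite v0; apply/matrixP => j k; rewrite mxE ord1.
  by apply/eqP; move/negbFE: (z0 j).
have zj1 : 1 <= z j 0 by rewrite -gtz0_ge1 lt_neqAle eq_sym zj z_ge0.
move: zsum; rewrite (bigD1 j) //= => zsum.
have rest_ge0 : 0 <= \sum_(i | i != j) z i 0 by apply: sumr_ge0.
have rest0 : \sum_(i | i != j) z i 0 = 0.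
  apply/eqP; rewrite eq_le rest_ge0 andbT -(lerD2l 1) addr0.
  by apply: le_trans zsum; rewrite lerD2r.
exists (lift ord0 j); rewrite vS; apply/matrixP => i k; rewrite !mxE ord1 eqxx andbT.
have [->|ij] := eqVneq i j.
  by apply/eqP; rewrite eq_le zj1 andbT; move: zsum; rewrite rest0 addr0.
by move/eqP: rest0; rewrite psumr_eq0 // => /allP /(_ i); rewrite mem_index_enum ij => /(_ isT) /eqP.
Qed.

Lemma cr_value_le (R : realType) (d k : nat) : `[< cr_value R d k >] -> (k <= d)%N.
Proof. by move=> /asboolP [v _ <-]; rewrite -[leqRHS]card_ord max_card. Qed.

Definition cr_e (R : realType) (d : nat) : nat :=
  ex_maxn (cr_value_inhabited R d) (@cr_value_le R d).

(* Main.v *)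
Require Import Defs.
From mathcomp Require Import all_boot all_order all_algebra.
From mathcomp Require Import boolp classical_sets reals.

Set Implicit Arguments.
Unset Strict Implicit.
Unset Printing Implicit Defensive.
Import Order.TTheory GRing.Theory Num.Theory.
Local Open Scope ring_scope.

(** A facet of an empty lattice simplex is an empty lattice simplex in the
    lattice of its hyperplane, so it suffices that passing to a facet lowers
    the cyclicity rank by at most one.  A prime p dividing the smallest
    elementary divisor larger than 1 divides all larger ones, so the cyclicity
    rank of A is the maximum over p of the corank of A modulo p.  In a lattice
    basis adapted to the hyperplane, the edge matrix of the facet is a minor of
    the edge matrix of the simplex with one row and one column removed, and
    the rank modulo p of a submatrix is at most that of the matrix. *)

(** * Ranks of submatrices and of diagonal matrices over a field *)

Lemma mxrank_mxsub (F : fieldType) m n m' n' (f : 'I_m' -> 'I_m)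
    (g : 'I_n' -> 'I_n) (A : 'M[F]_(m, n)) :
  (\rank (mxsub f g A) <= \rank A)%N.
Proof.
rewrite -[A in mxsub _ _ A]mulmx1 mxsub_mul rowsubE.
by apply: leq_trans (mxrankM_maxl _ _) _; apply: mxrankM_maxr.
Qed.

(** The principal submatrix on the nonzero entries is an invertible diagonal matrix. *)
Lemma mxrank_diag_ge (F : fieldType) n (s : 'rV[F]_n) :
  (#|[pred i | s 0%R i != 0%R]| <= \rank (diag_mx s))%N.
Proof.
set P := [pred i | _]; pose f (k : 'I_#|P|) : 'I_n := enum_val k.
apply: leq_trans (mxrank_mxsub f f _).
rewrite mxrank_unit // (_ : mxsub f f _ = diag_mx (\row_k s 0 (f k))).
  rewrite unitmxE det_diag unitfE prodf_seq_neq0; apply/allP => k _.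
  by rewrite mxE; apply: (enum_valP k).
by apply/matrixP => k l; rewrite !mxE (inj_eq enum_val_inj).
Qed.

(* The upper bound comes from the lower bound for the indicator of the zero
   entries, whose diagonal matrix annihilates that of [s]. *)
Lemma mxrank_diag (F : fieldType) n (s : 'rV[F]_n) :
  \rank (diag_mx s) = #|[pred i | s 0 i != 0%R]|.
Proof.
apply/eqP; rewrite eqn_leq mxrank_diag_ge andbT.
pose t : 'rV[F]_n := \row_i (s 0 i == 0)%:R.
have st0 : diag_mx s *m diag_mx t = 0.
  rewrite mulmx_diag; apply/matrixP => i j; rewrite !mxE.
  by case: (s 0 i =P 0) => [->|_]; rewrite ?mul0r ?mulr0 mul0rn.
rewrite -(leq_add2r (\rank (diag_mx t))).
apply: leq_trans (mulmx0_rank_max st0) _.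
rewrite -[leqLHS]card_ord -(cardC [pred i | s 0 i != 0]) leq_add2l.
apply: leq_trans (mxrank_diag_ge t); apply: subset_leq_card.
apply/fintype.subsetP => i; rewrite !inE negbK mxE => ->.
exact: oner_neq0.
Qed.

Lemma map_unitmx_rmorph (aR rR : comUnitRingType) (f : {rmorphism aR -> rR})
    n (A : 'M[aR]_n) : A \in unitmx -> map_mx f A \in unitmx.
Proof. by rewrite !unitmxE det_map_mx; apply: rmorph_unit. Qed.

(** * Reduction modulo a prime *)

Section ModP.
Variable p : nat.
Hypothesis p_pr : prime p.

Definition mx_modp m n (A : 'M[int]_(m, n)) : 'M['F_p]_(m, n) := map_mx intr A.

Lemma mxrank_modp_unitl n (U A : 'M[int]_n) :
  U \in unitmx -> \rank (mx_modp (U *m A)) = \rank (mx_modp A).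
Proof.
move=> uU; rewrite /mx_modp map_mxM eqmxMfull //.
by rewrite row_full_unit map_unitmx_rmorph.
Qed.

(** Unimodular factors stay invertible modulo [p], so only the diagonal factor matters, and its
    entries divisible by [p] become zero. *)
Lemma mxrank_modp_smith n (A : 'M[int]_n) s :
  smith_form A s ->
  (\rank (mx_modp A) + #|[pred i | (p %| s 0%R i)%Z]|)%N = n.
Proof.
move=> [_ _ [P [Q [uP uQ ->]]]].
rewrite -mulmxA mxrank_modp_unitl // /mx_modp map_mxM mxrankMfree; last first.
  by rewrite row_free_unit map_unitmx_rmorph.
rewrite map_diag_mx mxrank_diag -[RHS]card_ord.
rewrite -(cardC [pred i | (p %| s 0%R i)%Z]) addnC; congr (_ + _)%N.
by apply: eq_card => i; rewrite !inE mxE (dvdz_pcharf (pchar_Fp p_pr)).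
Qed.

End ModP.

(** * Elementary divisors and coranks modulo primes *)

Section SmithForm.
Variables (n : nat) (A : 'M[int]_n).
Let s := elementary_divisors A.

(** For [A = edge_matrix v] this unfolds to the same term as [cyclicity_rank v]; the rank argument
    thus applies to arbitrary integer matrices. *)
Definition elementary_rank : nat := #|[pred i | 1 < s 0 i]|.

(** Since the determinant is nonzero, so is every elementary divisor; one divisible by [p] is then
    at least [p], hence larger than 1. *)
Lemma corank_modp_le_elementary_rank p :
  prime p -> \det A != 0 ->
  (n <= \rank (mx_modp p A) + elementary_rank)%N.
Proof.
move=> p_pr detA; have sA := elementary_divisorsP A.
rewrite -[leqLHS](mxrank_modp_smith p_pr sA) leq_add2l.
apply/subset_leq_card/fintype.subsetP => i; rewrite !inE => p_dvd.
have [s_ge0 _ [P [Q [_ _ eA]]]] := sA.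
have s_neq0 : s 0 i != 0.
  apply: contraNneq detA => si0; rewrite eA !det_mulmx det_diag (bigD1 i) //=.
  by rewrite si0 mul0r mulr0 mul0r.
move: p_dvd s_neq0; have := s_ge0 i; rewrite -/s; case: (s 0 i) => // k _.
rewrite dvdzE /= => p_dvd k_neq0.
by apply: leq_trans (prime_gt1 p_pr) (dvdn_leq _ p_dvd); rewrite lt0n.
Qed.

Lemma elementary_rank_le_corank_modp :
  (0 < elementary_rank)%N ->
  exists2 p, prime p & (\rank (mx_modp p A) + elementary_rank <= n)%N.
Proof.
move=> /card_gt0P[i0 i0P]; have sA := elementary_divisorsP A.
(* By the divisibility chain, a prime factor of the first elementary divisor larger than 1 divides
   all later ones. *)
case: (arg_minnP val i0P) => i /= si_gt1 i_min.
have ai_gt1 : (1 < absz (s 0%R i))%N by move: si_gt1; case: (s 0 i).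
exists (pdiv (absz (s 0%R i))); first exact: pdiv_prime.
rewrite -[leqRHS](mxrank_modp_smith (pdiv_prime ai_gt1) sA) leq_add2l.
apply/subset_leq_card/fintype.subsetP => j sj_gt1; rewrite !inE.
have [_ s_dvd _] := sA.
apply: dvdz_trans (s_dvd _ _ (i_min j sj_gt1)).
by rewrite dvdzE /= pdiv_dvd.
Qed.

End SmithForm.

Lemma elementary_rank_minor n (A U : 'M[int]_n.+1) (B : 'M[int]_n)
    (f g : 'I_n -> 'I_n.+1) :
  U \in unitmx -> B = mxsub f g (U *m A) -> \det B != 0 ->
  (elementary_rank A <= elementary_rank B + 1)%N.
Proof.
move=> uU BE detB.
(* With no elementary divisor larger than 1 there is no prime to pick, but the bound is trivial. *)
have [->//|] := posnP (elementary_rank A).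
move=> /elementary_rank_le_corank_modp[p p_pr rkA].
have := corank_modp_le_elementary_rank p_pr detB.
have rkB : (\rank (mx_modp p B) <= \rank (mx_modp p A))%N.
  rewrite -(mxrank_modp_unitl p A uU) BE /mx_modp map_mxsub.
  exact: mxrank_mxsub.
(* The sizes of [A] and [B] differ by one, whence the extra 1. *)
move=> rkB'; rewrite -(leq_add2l (\rank (mx_modp p A))).
apply: leq_trans rkA _; rewrite addn1 addnS ltnS.
by apply: leq_trans rkB' _; rewrite leq_add2r.
Qed.

(** * Lattice points and the edge matrix *)

Section LatticePoint.
Variables (R : realType).

Lemma lattice_point_inj n : injective (@lattice_point R n).
Proof.
move=> x y /matrixP xy; apply/matrixP => i j.
by apply: (@intr_inj R); have := xy i j; rewrite !mxE.
Qed.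

Lemma lattice_pointB n (x y : 'cV[int]_n) :
  lattice_point R (x - y) = lattice_point R x - lattice_point R y.
Proof. exact: map_mxB. Qed.

Lemma lattice_pointM m n (A : 'M[int]_(m, n)) (x : 'cV[int]_n) :
  lattice_point R (A *m x) = map_mx intr A *m lattice_point R x.
Proof. exact: map_mxM. Qed.

Lemma det_edge_matrix_neq0 n (v : 'I_n.+1 -> 'cV[int]_n) :
  lattice_simplex R v -> \det (edge_matrix v) != 0.
Proof.
move=> v_ind; apply/negP => /eqP det0.
have : \det (map_mx intr (edge_matrix v) : 'M[R]_n)^T == 0.
  by rewrite det_tr det_map_mx det0 rmorph0.
case/det0P => u /eqP u_neq0 uA; apply: u_neq0; apply/rowP => j; rewrite mxE.
(* A kernel vector [u] of the edge matrix becomes an affine dependence: the coefficient of the base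
   vertex makes the sum zero. *)
pose c i := if unlift ord0 i is Some j then u 0 j else - \sum_j u 0 j.
have c0 : c ord0 = - \sum_j u 0 j by rewrite /c unlift_none.
have cS k : c (lift ord0 k) = u 0 k by rewrite /c liftK.
rewrite -cS; apply: v_ind.
  by rewrite big_ord_recl c0 (eq_bigr _ (fun k _ => cS k)) addNr.
rewrite big_ord_recl c0 scaleNr scaler_suml addrC -sumrB.
rewrite -[RHS]trmx0 -uA trmx_mul trmxK; apply/colP => i.
rewrite summxE !mxE; apply: eq_bigr => k _.
by rewrite cS !mxE rmorphB /= -mulrBr mulrC.
Qed.

End LatticePoint.

Lemma widen_ord_lift m (i : 'I_m) : widen_ord (leqnSn m) i = lift ord_max i.
Proof. by apply: val_inj; rewrite /= /bump leqNgt ltn_ord. Qed.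

(** * The facet opposite the last vertex *)

Section Facet.
Variables (R : realType) (n : nat) (v : 'I_n.+2 -> 'cV[int]_n.+1).
Hypothesis v_empty : empty_lattice_simplex R v.
Variable U : 'M[int]_n.+1.
Hypothesis U_unit : U \in unitmx.

Let wid m (i : 'I_m) : 'I_m.+1 := widen_ord (leqnSn m) i.
Let u (j : 'I_n.+1) := U *m (v (wid j) - v ord0).
Hypothesis u_last : forall j, u j ord_max 0 = 0.
(** The facet's vertices in the adapted basis, without their last coordinate, which is zero; [embed]
    puts it back. *)
Let w (j : 'I_n.+1) : 'cV[int]_n := rowsub (@wid n) (u j).

Let embed (x : 'cV[int]_n) : 'cV[int]_n.+1 :=
  \col_i (if unlift ord_max i is Some k then x k 0 else 0).

(** Undoes [U] and the translation; each term brings back [c j] times the base vertex, whence the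
    factor [\sum_j c j]. *)
Lemma facet_combination (c : 'I_n.+1 -> R) (x : 'cV[int]_n) :
  \sum_j c j *: lattice_point R (w j) = lattice_point R x ->
  \sum_j c j *: lattice_point R (v (wid j)) =
    (\sum_j c j) *: lattice_point R (v ord0) +
    lattice_point R (invmx U *m embed x).
Proof.
move=> cw.
have cu : \sum_j c j *: lattice_point R (u j) = lattice_point R (embed x).
  apply/colP => i; rewrite summxE.
  have [k ->|->] := unliftP ord_max i.
    rewrite !mxE liftK.
    move/colP/(_ k): cw; rewrite summxE !mxE => <-; apply: eq_bigr => j _.
    by rewrite /w /wid /lattice_point !(mxE, widen_ord_lift).
  rewrite !mxE unlift_none big1 // => j _.
  by rewrite 2!mxE u_last mulr0.
rewrite lattice_pointM -cu mulmx_sumr scaler_suml -big_split /=.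
apply: eq_bigr => j _.
rewrite -scalemxAr -lattice_pointM mulKmx // lattice_pointB scalerBr.
by rewrite addrC subrK.
Qed.

Let extend (c : 'I_n.+1 -> R) (a : R) (i : 'I_n.+2) : R :=
  if unlift ord_max i is Some k then c k else a.

Let extendW c a j : extend c a (wid j) = c j.
Proof. by rewrite /extend /wid widen_ord_lift liftK. Qed.

Let extendM c a : extend c a ord_max = a.
Proof. by rewrite /extend unlift_none. Qed.

(** The coefficient [a] of the opposite vertex is kept general: [a = 0] gives independence of the
    facet, [a = -1] keeps the opposite vertex out of its affine hull. *)
Lemma facet_affinely_independent (c : 'I_n.+1 -> R) (a : R) :
  \sum_j c j + a = 0 ->
  \sum_j c j *: lattice_point R (v (wid j)) +
    a *: lattice_point R (v ord_max) = 0 ->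
  (forall j, c j = 0) /\ a = 0.
Proof.
move=> c0 cv; have [v_ind _] := v_empty.
have e0 : forall i, extend c a i = 0.
  apply: v_ind; rewrite big_ord_recr /= extendM.
    by under eq_bigr do rewrite extendW.
  by under eq_bigr do rewrite extendW.
by split=> [j|]; [rewrite -(e0 (wid j)) extendW|rewrite -(e0 ord_max) extendM].
Qed.

Lemma facet_empty : empty_lattice_simplex R w.
Proof.
split=> [c c0 cw|z [c [c_ge0 c1 zE]]].
  have := @facet_combination c 0; rewrite cw [lattice_point R 0]map_mx0.
  have -> : embed 0 = 0.
    by apply/colP => i; rewrite !mxE; case: unlift => // k; rewrite mxE.
  rewrite mulmx0 [lattice_point R 0]map_mx0 c0 scale0r addr0 => /(_ erefl) cv.
  have [] // := @facet_affinely_independent c 0; first by rewrite addr0.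
  by rewrite scale0r addr0.
have cv := facet_combination (esym zE); rewrite c1 scale1r in cv.
have [_ v_latt] := v_empty.
(* As [U] is unimodular, [z] lifts to a lattice point of the original simplex, hence to one of its
   vertices. *)
pose y := v ord0 + invmx U *m embed z.
have yE : lattice_point R y = \sum_j c j *: lattice_point R (v (wid j)).
  by rewrite cv /lattice_point map_mxD.
have [|i yi] := v_latt y.
  exists (extend c 0); split.
  - by move=> i; rewrite /extend; case: unlift.
  - by rewrite big_ord_recr /= extendM addr0; under eq_bigr do rewrite extendW.
  - rewrite big_ord_recr /= extendM scale0r addr0 yE.
    by apply: eq_bigr => j _; rewrite extendW.
have [j ij|iM] := unliftP ord_max i; last first.
  have [||_ /eqP] := @facet_affinely_independent c (-1).
  - by rewrite c1 subrr.
  - by rewrite -yE yi iM scaleN1r subrr.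
  - by rewrite oppr_eq0 oner_eq0.
have iw : i = wid j by rewrite ij /wid widen_ord_lift.
exists j; apply/colP => k; rewrite mxE /u -iw -yi /y addrC addKr mulKVmx //.
by rewrite mxE /wid widen_ord_lift liftK.
Qed.

(** The base vertex is common to the facet and the simplex, and [u] vanishes there, so the
    translation leaves the edges unchanged. *)
Lemma facet_edge_matrix :
  edge_matrix w = mxsub (@wid n) (@wid n) (U *m edge_matrix v).
Proof.
have wid0 : wid (ord0 : 'I_n.+1) = ord0 by apply: val_inj.
apply/matrixP => i j; rewrite !mxE wid0 -sumrB.
apply: eq_bigr => k _; rewrite !mxE subrr mulr0 subr0.
by congr (_ * (v _ _ _ - _)); apply: val_inj.
Qed.

End Facet.

(* The hyperplane of the facet becomes the last coordinate hyperplane under the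
   inverse of the left factor of a Smith form of the facet's edges: the Smith
   form of a matrix with more rows than columns has a zero last row. *)
Lemma facet_straightening n (v : 'I_n.+2 -> 'cV[int]_n.+1) :
  exists2 U : 'M[int]_n.+1, U \in unitmx &
    forall j : 'I_n.+1,
      (U *m (v (widen_ord (leqnSn n.+1) j) - v ord0)) ord_max 0 = 0.
Proof.
pose E : 'M[int]_(n.+1, n) := colsub (widen_ord (leqnSn n)) (edge_matrix v).
have [L uL [Q uQ [s _ EE]]] := int_Smith_normal_form E.
exists (invmx L); first by rewrite unitmx_inv.
move=> j; have [k ->|->] := unliftP ord0 j; last first.
  rewrite (_ : widen_ord _ _ = ord0) ?subrr ?mulmx0 ?mxE //.
  exact: val_inj.
rewrite (_ : _ - _ = col k E); last first.
  apply/colP => i; rewrite !mxE; congr (v _ _ _ - _).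
  exact: val_inj.
rewrite colE mulmxA -colE [E]EE -mulmxA mulKmx // !mxE big1 // => l _.
by rewrite mxE eq_sym (ltn_eqF (ltn_ord l)) mulr0n mul0r.
Qed.

Theorem theorem4p2 (R : realType) (d : nat) (hd : (2 <= d)%N) :
  (cr_e R d <= cr_e R (d - 1) + 1)%N.
Proof.
case: d hd => [//|n _]; rewrite subn1 /=.
rewrite {1}/cr_e; case: ex_maxnP => k /asboolP[v v_empty <-] _.
have [U uU u_last] := facet_straightening v.
have w_empty := facet_empty v_empty uU u_last.
apply: leq_trans (elementary_rank_minor uU (facet_edge_matrix v U) _) _.
  exact: det_edge_matrix_neq0 w_empty.1.
rewrite leq_add2r /cr_e; case: ex_maxnP => m _; apply.
by apply/asboolP; eexists; first exact: w_empty.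
Qed.
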